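(* Let $f_1,\dots,f_m:\mathbb{R}^n\to\mathbb{R}$ be convex and continuously differentiable, each $\nabla f_i$ being $L_i$-Lipschitz continuous for a given $L_i\ge 0$. Let $g:\mathbb{R}^m\to\mathbb{R}$ be finite valued, convex, globally $L_g$-Lipschitz continuous (with respect to the Euclidean norm), and nondecreasing in its $i$-th argument for every $i$ with $L_i>0$. Put $F=(f_1,\dots,f_m)$, $\bm{L}=(L_1,\dots,L_m)^T$ and $H(x,y)=F(x)+\nabla F(x)(y-x)+\frac{\bm{L}}{2}\|y-x\|^2$. Assume that $g\circ F$ has a minimizer and let $S=\mathrm{argmin}\,g\circ F$. Let $(x_k)_{k\in\mathbb{N}}$ be a sequence generated by the multiproximal method: $x_0\in\mathbb{R}^n$ and, for every $k\in\mathbb{N}$, $x_{k+1}\in p(x_k)$, with $x_{k+1}=x_k$ whenever $x_k\in p(x_k)$. Then $(x_k)$ converges to a minimizer of $g\circ F$ and, for any $x_*\in S$, $$g(F(x_k))-g(F(x_* ))\le\frac{L_g\|\bm{L}\|}{2k}\,\|x_0-x_*\|^2,\qquad\forall k\ge1.$$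
   Context: $\|\cdot\|$ is the Euclidean norm; $\nabla F(x)$ is the $m\times n$ Jacobian of $F$ at $x$; $p(x)=\mathrm{argmin}_{y\in\mathbb{R}^n}\,g(H(x,y))$. *)

(* Defs.v *)
From HB Require Import structures.
From mathcomp Require Import all_boot all_order all_algebra.
From mathcomp Require Import all_classical all_reals all_analysis.

Set Implicit Arguments.
Unset Strict Implicit.
Unset Printing Implicit Defensive.

Import Order.TTheory GRing.Theory Num.Theory.
Import numFieldNormedType.Exports.

Local Open Scope classical_set_scope.
Local Open Scope ring_scope.

(* Euclidean norm. It is kept separate from the norm `|x| that the library
   puts on 'rV[R]_n, which is the sup norm; the two norms are equivalent,
   so the library topology is the usual one. *)
Definition enorm (R : realType) (n : nat) (x : 'rV[R]_n) : R :=
  Num.sqrt (\sum_(i < n) x 0 i ^+ 2).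

Definition elipschitz (R : realType) (n p : nat) (k : R)
    (f : 'rV[R]_n -> 'rV[R]_p) : Prop :=
  forall x y, enorm (f x - f y) <= k * enorm (x - y).

Definition gradient (R : realType) (n : nat) (f : 'rV[R]_n -> R)
    (x : 'rV[R]_n) : 'rV[R]_n :=
  \row_(j < n) 'D_(delta_mx 0 j) f x.

Definition continuously_differentiable (R : realType) (n : nat)
    (f : 'rV[R]_n -> R) : Prop :=
  (forall x, differentiable f x) /\ continuous (gradient f).

Definition nondecreasing_in (R : realType) (m : nat) (i : 'I_m)
    (g : 'rV[R]_m -> R) : Prop :=
  forall u v : 'rV[R]_m,
    (forall j, j != i -> u 0 j = v 0 j) -> u 0 i <= v 0 i -> g u <= g v.

Definition argmin (R : realType) (T : Type) (phi : T -> R) : set T :=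
  [set y | forall z, phi y <= phi z].

Definition vecfun (R : realType) (n m : nat) (f : 'I_m -> 'rV[R]_n -> R)
    (x : 'rV[R]_n) : 'rV[R]_m :=
  \row_(i < m) f i x.

(* H(x, y). Points are row vectors and the library Jacobian 'J F x is n x m, the
   transpose of the usual m x n one: (y - x) *m 'J F x is \nabla F(x)(y - x). *)
Definition upper_model (R : realType) (n m : nat) (F : 'rV[R]_n -> 'rV[R]_m)
    (L : 'rV[R]_m) (x y : 'rV[R]_n) : 'rV[R]_m :=
  F x + (y - x) *m 'J F x + (enorm (y - x) ^+ 2 / 2) *: L.

(* p(x), the set of all minimizers of y |-> g (H(x, y)) *)
Definition multiprox_step (R : realType) (n m : nat) (F : 'rV[R]_n -> 'rV[R]_m)
    (g : 'rV[R]_m -> R) (L : 'rV[R]_m) (x : 'rV[R]_n) : set 'rV[R]_n :=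
  argmin (fun y => g (upper_model F L x y)).

Definition multiproximal_sequence (R : realType) (n m : nat)
    (F : 'rV[R]_n -> 'rV[R]_m) (g : 'rV[R]_m -> R) (L : 'rV[R]_m)
    (x : nat -> 'rV[R]_n) : Prop :=
  forall k, multiprox_step F g L (x k) (x k.+1) /\
    (multiprox_step F g L (x k) (x k) -> x k.+1 = x k).

(* Main.v *)
Require Import Defs.
From HB Require Import structures.
From mathcomp Require Import all_boot all_order all_algebra.
From mathcomp Require Import all_classical all_reals all_analysis.
From mathcomp Require Import ring lra.

(** Since [f i <= H_i <= f i + L_i / 2 |y - x|^2] with equality when [L_i = 0],
    evaluating the quadratic model on the segment from [x_{k+1}] to a solution
    [s] gives
    [g (H (x_k, x_{k+1})) <=
       g (F s + (|s - x_k|^2 - |s - x_{k+1}|^2) / 2 *: L)].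
    If [x_{k+1}] is farther from [s] than [x_k], monotonicity of [g] makes
    [x_{k+1}] a solution, and the sequence is constant from then on. Otherwise
    the Lipschitz bound on [g] turns the inequality into a telescoping one,
    which yields the rate; the sequence is then also Fejer monotone with respect
    to the solution set, hence converges. *)

Set Implicit Arguments.
Unset Strict Implicit.
Unset Printing Implicit Defensive.

Import Order.TTheory GRing.Theory Num.Theory.
Import numFieldNormedType.Exports.

Local Open Scope classical_set_scope.
Local Open Scope ring_scope.

(** * Euclidean norm and inner product, and their comparison with the sup norm *)

Section Euclidean.
Context {R : realType} {n : nat}.
Implicit Types u v w : 'rV[R]_n.

Definition edot u v : R := \sum_(i < n) u 0 i * v 0 i.

Lemma enorm_ge0 u : 0 <= enorm u.
Proof. exact: sqrtr_ge0. Qed.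

Lemma sqr_enorm u : enorm u ^+ 2 = \sum_(i < n) u 0 i ^+ 2.
Proof. by rewrite sqr_sqrtr// sumr_ge0// => i _; rewrite sqr_ge0. Qed.

Lemma enorm0 : enorm (0 : 'rV[R]_n) = 0.
Proof. by rewrite /enorm big1 ?sqrtr0// => i _; rewrite mxE expr0n. Qed.

Lemma enormZ (a : R) u : enorm (a *: u) = `|a| * enorm u.
Proof.
rewrite /enorm -sqrtr_sqr -sqrtrM ?sqr_ge0// mulr_sumr.
by congr Num.sqrt; apply: eq_bigr => i _; rewrite mxE exprMn.
Qed.

Lemma enorm_convex_comb (t : R) u v :
  enorm ((1 - t) *: u + t *: v) ^+ 2 =
  (1 - t) * enorm u ^+ 2 + t * enorm v ^+ 2 - t * (1 - t) * enorm (v - u) ^+ 2.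
Proof.
rewrite !sqr_enorm !mulr_sumr -big_split -sumrB/=.
by apply: eq_bigr => i _; rewrite !mxE; ring.
Qed.

Lemma edotBl u v w : edot (u - v) w = edot u w - edot v w.
Proof. by rewrite -sumrB; apply: eq_bigr => i _; rewrite !mxE mulrBl. Qed.

Lemma coord_le_enorm u i : `|u 0 i| <= enorm u.
Proof.
rewrite -sqrtr_sqr ler_wsqrtr// (bigD1 i)//= lerDl sumr_ge0// => j _.
exact: sqr_ge0.
Qed.

Lemma enorm_eq0 u : enorm u = 0 -> u = 0.
Proof.
move=> u0; apply/rowP => i; apply/eqP.
by rewrite mxE -normr_le0 -u0 coord_le_enorm.
Qed.

(** Cauchy-Schwarz: the square of [enorm u *: v - enorm v *: u] expands to
    [2 |u| |v| (|u| |v| - <u, v>)]. The case [|u| |v| = 0] is treated apart because this factor is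
    cancelled. *)
Lemma edot_le_enorm u v : edot u v <= enorm u * enorm v.
Proof.
have [uv0|uv0] := eqVneq (enorm u * enorm v) 0.
  rewrite uv0 le_eqVlt; apply/orP; left.
  move/eqP : uv0; rewrite mulf_eq0 => /orP[] /eqP/enorm_eq0 ->.
    by rewrite /edot big1// => i _; rewrite mxE mul0r.
  by rewrite /edot big1// => i _; rewrite mxE mulr0.
have uv_gt0 : 0 < enorm u * enorm v.
  by rewrite lt_neqAle eq_sym uv0 mulr_ge0 ?enorm_ge0.
have : 0 <= enorm (enorm u *: v - enorm v *: u) ^+ 2 by rewrite sqr_ge0.
have -> : enorm (enorm u *: v - enorm v *: u) ^+ 2 =
    2 * (enorm u * enorm v) * (enorm u * enorm v - edot u v).
  transitivity (enorm u ^+ 2 * enorm v ^+ 2 + enorm v ^+ 2 * enorm u ^+ 2 -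
      2 * (enorm u * enorm v) * edot u v); last by ring.
  rewrite [in LHS]sqr_enorm [X in _ * X + _]sqr_enorm.
  rewrite [X in _ + _ * X - _]sqr_enorm /edot !mulr_sumr -big_split -sumrB/=.
  by apply: eq_bigr => i _; rewrite !mxE; ring.
by rewrite pmulr_rge0 ?subr_ge0// mulr_gt0.
Qed.

Lemma norm_le_enorm u : `|u| <= enorm u.
Proof.
rewrite [leLHS]/Num.Def.normr/= mx_normrE.
apply: bigmax_le; first exact: enorm_ge0.
by move=> [i j] _ /=; rewrite ord1 coord_le_enorm.
Qed.

Lemma enorm_le_norm u : enorm u <= Num.sqrt n%:R * `|u|.
Proof.
rewrite -[X in _ * X](ger0_norm (normr_ge0 u)) -sqrtr_sqr -sqrtrM//.
rewrite ler_wsqrtr// mulr_natl -[X in _ *+ X]card_ord -sumr_const.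
apply: ler_sum => i _; rewrite -[leLHS]real_normK ?num_real// lerXn2r ?nnegrE//.
rewrite [leRHS]/Num.Def.normr/= mx_normrE.
exact: (le_bigmax _ (fun ij : 'I_1 * 'I_n => `|u ij.1 ij.2|) (0, i)).
Qed.

End Euclidean.

(** Pass from [u] to [v] one coordinate at a time: the hybrid [w k] has its first [k] entries from
    [v] and the others from [u], so consecutive hybrids differ at most in one entry. *)
Lemma nondecreasing_in_le (R : realType) (m : nat) (g : 'rV[R]_m -> R)
    (P : pred 'I_m) (u v : 'rV[R]_m) :
  (forall i, P i -> nondecreasing_in i g) ->
  (forall i, P i -> u 0 i <= v 0 i) -> (forall i, ~~ P i -> u 0 i = v 0 i) ->
  g u <= g v.
Proof.
move=> gP leuv equv.
pose w k : 'rV[R]_m := \row_i if (i < k)%N then v 0 i else u 0 i.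
have w0 : w 0%N = u by apply/rowP => i; rewrite mxE.
have wm : w m = v by apply/rowP => i; rewrite mxE ltn_ord.
rewrite -w0 -wm.
suff H k : (k <= m)%N -> g (w 0%N) <= g (w k) by exact: H.
elim: k => // k IHk km; apply: le_trans (IHk (ltnW km)) _.
pose i := Ordinal km.
have wE j : j != i -> w k 0 j = w k.+1 0 j.
  move=> ji; rewrite !mxE ltnS [in RHS]leq_eqVlt.
  by rewrite (negbTE (ji : (j != k :> nat))).
have [Pi|nPi] := boolP (P i).
  by apply: (gP i) => //; rewrite !mxE/= ltnn ltnSn leuv.
have -> : w k.+1 = w k; last by [].
apply/rowP => j; have [->|/wE//] := eqVneq j i.
by rewrite !mxE/= ltnn ltnSn equv.
Qed.

(** * First-order bounds: tangent below a convex function, parabola above a smooth one *)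

Section Differentiation.
Context {R : realType} {n : nat}.
Implicit Types (f : 'rV[R]_n -> R) (x y d : 'rV[R]_n).

Lemma derive_gradient f x d : differentiable f x ->
  'D_d f x = edot (gradient f x) d.
Proof.
move=> fx; rewrite deriveE// [in LHS](row_sum_delta d) linear_sum.
by apply: eq_bigr => i _; rewrite linearZ /= mxE deriveE// mulrC.
Qed.

Lemma is_derive_line f x d (t : R) : differentiable f (x + t *: d) ->
  is_derive t 1 (fun s : R => f (x + s *: d)) ('D_d f (x + t *: d)).
Proof.
move=> fx; have fd : derivable f (x + t *: d) d by exact: diff_derivable.
have E : (fun h : R => h^-1 *:
      (((fun s : R => f (x + s *: d)) \o shift t) (h *: 1) - f (x + t *: d))) =
  (fun h : R => h^-1 *: ((f \o shift (x + t *: d)) (h *: d) - f (x + t *: d))).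
  apply/funext => h /=; congr (_ *: (f _ - _)).
  by rewrite [h%:A]mulr1 scalerDl addrCA.
by split; rewrite /derivable /derive E.
Qed.

Lemma convex_ge_tangent f x y : convex_function setT f -> differentiable f x ->
  f x + edot (gradient f x) (y - x) <= f y.
Proof.
move=> fconv fx; rewrite -derive_gradient//.
have /cvg_ex[l fl] : derivable f x (y - x) by exact: diff_derivable.
have -> : 'D_(y - x) f x = l by exact: cvg_lim.
rewrite -lerBrDl.
(* Convexity bounds the difference quotient only for [0 < h <= 1], so the limit is restricted to the
   right of 0. *)
have {}fl : (h^-1 *: ((f \o shift x) (h *: (y - x)) - f x)) @[h --> 0^'+] --> l.
  apply: cvg_trans fl; apply: cvg_app => A [e e0 eA]; exists e => // h he h0.
  by apply: eA => //; rewrite gt_eqF.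
apply: (cvgr_to_le fl).
near=> h => /=.
have h0 : 0 < h by [].
have h1 : h <= 1 by near: h; exact: nbhs_right_le.
have := fconv (Itv01 (ltW h0) h1) y x (in_setT _) (in_setT _).
rewrite /conv/= /unstable.onem => fle.
rewrite [_ *: _]mulrC ler_pdivrMr// lerBlDr.
apply: le_trans (le_trans _ fle) _.
  rewrite le_eqVlt; apply/orP; left; apply/eqP; congr f.
  by apply/rowP => i; rewrite !mxE; ring.
rewrite -[leLHS]/(h * f y + (1 - h) * f x) le_eqVlt.
by apply/orP; left; apply/eqP; ring.
Unshelve. all: by end_near.
Qed.

(** Along the segment, [psi] is [f] minus its candidate upper bound, up to a constant. Its
    derivative is nonpositive on [[0, 1]] by Cauchy-Schwarz and the Lipschitz gradient, so the mean
    value theorem gives [psi 1 <= psi 0] without any integral. *)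
Lemma descent_lemma f (k : R) x y :
  (forall z, differentiable f z) -> elipschitz k (gradient f) ->
  f y <= f x + edot (gradient f x) (y - x) + k / 2 * enorm (y - x) ^+ 2.
Proof.
move=> fdiff flip; set d := y - x.
pose phi (t : R) := f (x + t *: d).
pose psi (t : R) :=
  phi t - t * edot (gradient f x) d - t ^+ 2 * (k / 2 * enorm d ^+ 2).
pose dpsi (t : R) := edot (gradient f (x + t *: d)) d - edot (gradient f x) d
  - t * (k * enorm d ^+ 2).
have psiD (t : R) : is_derive t (1 : R) psi (dpsi t).
  have phiD := is_derive_line (fdiff (x + t *: d)).
  rewrite derive_gradient// -/phi in phiD.
  have -> : psi = phi - (edot (gradient f x) d \*: id) -
      ((k / 2 * enorm d ^+ 2) \*: (fun t : R => t ^+ 2)).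
    by apply/funext => s; rewrite /psi !fctE/= -![_ *: _]/(_ * _); ring.
  apply: is_derive_eq.
  rewrite /dpsi; set G := edot (gradient f (x + t *: d)) d.
  by rewrite /GRing.scale/=; field.
have psi_cont : {within `[0, 1], continuous psi}.
  apply: derivable_within_continuous => t _.
  by have := psiD t; exact: @ex_derive.
have [c] := MVT (@ltr01 R) (fun t _ => psiD t) psi_cont.
rewrite in_itv/= => /andP[/ltW c0 _].
rewrite /psi /phi scale1r scale0r addr0 {1}/d [x + _]addrC subrK => fE.
suff : dpsi c <= 0 by move: fE; lra.
rewrite /dpsi -edotBl subr_le0.
apply: le_trans (edot_le_enorm _ _) _.
have := flip (x + c *: d) x.
rewrite addrAC subrr add0r enormZ ger0_norm// => {}flip.
apply: le_trans (ler_wpM2r (enorm_ge0 _) flip) _.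
by rewrite le_eqVlt; apply/orP; left; apply/eqP; ring.
Qed.

End Differentiation.

(** * The quadratic model: coordinates, two-sided bounds, behaviour on segments *)

Section VectorFunctions.
Context {R : realType} {n m : nat}.
Variable f : 'I_m -> 'rV[R]_n -> R.
Hypothesis f_diff : forall i x, differentiable (f i) x.
Implicit Types (x y : 'rV[R]_n) (L : 'rV[R]_m).

Lemma differentiable_vecfun x : differentiable (vecfun f) x.
Proof.
have -> : vecfun f = \sum_(i < m) (fun y => f i y *: (delta_mx 0 i : 'rV[R]_m)).
  apply/funext => y; rewrite fct_sumE [LHS]row_sum_delta.
  by apply: eq_bigr => i _; rewrite mxE.
by apply: differentiable_sum => i; exact: differentiableZl.
Qed.

Lemma upper_modelE L x y i : upper_model (vecfun f) L x y 0 i =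
  f i x + edot (gradient (f i) x) (y - x) + L 0 i / 2 * enorm (y - x) ^+ 2.
Proof.
rewrite /upper_model -deriveEjacobian; last exact: differentiable_vecfun.
rewrite derive_mx; last by apply: diff_derivable; exact: differentiable_vecfun.
rewrite !mxE -derive_gradient//.
have -> : (fun t => vecfun f t 0 i) = f i by apply/funext => t; rewrite mxE.
by ring.
Qed.

Lemma le_upper_model L x y i : elipschitz (L 0 i) (gradient (f i)) ->
  f i y <= upper_model (vecfun f) L x y 0 i.
Proof. by move=> ?; rewrite upper_modelE; exact: descent_lemma. Qed.

Lemma upper_model_le L x y i : convex_function setT (f i) ->
  upper_model (vecfun f) L x y 0 i <= f i y + L 0 i / 2 * enorm (y - x) ^+ 2.
Proof. by move=> ?; rewrite upper_modelE lerD2r; exact: convex_ge_tangent. Qed.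

End VectorFunctions.

Lemma upper_model_refl (R : realType) (n m : nat)
    (F : 'rV[R]_n -> 'rV[R]_m) L x :
  upper_model F L x x = F x.
Proof.
by rewrite /upper_model subrr mul0mx enorm0 expr0n mul0r scale0r !addr0.
Qed.

(** The model is affine in its second point up to a squared norm, whose convexity defect is known
    exactly. Keeping this defect is what later produces the term [- |y - z|^2] that telescopes. *)
Lemma upper_model_segment (R : realType) (n m : nat) (F : 'rV[R]_n -> 'rV[R]_m)
    (L : 'rV[R]_m) (x z y : 'rV[R]_n) (t : R) :
  upper_model F L x ((1 - t) *: z + t *: y) =
  (1 - t) *: upper_model F L x z + t *: upper_model F L x y
    - (t * (1 - t) / 2 * enorm (y - z) ^+ 2) *: L.
Proof.
rewrite /upper_model.
have -> : (1 - t) *: z + t *: y - x = (1 - t) *: (z - x) + t *: (y - x).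
  by apply/rowP => j; rewrite !mxE; ring.
rewrite enorm_convex_comb mulmxDl -!scalemxAl.
have -> : y - x - (z - x) = y - z by apply/rowP => j; rewrite !mxE; ring.
move: (_ *m _) (_ *m _) => u v.
by apply/rowP => i; rewrite !mxE; ring.
Qed.

(** The sequence stays in a compact ball around a point of [S], so it has a cluster point [l], which
    lies in [S]. Distances to [l] are then nonincreasing too, and coming close to [l] once means
    staying close. *)
Lemma fejer_cvg (R : realType) (n : nat) (S : set 'rV[R]_n)
    (x : nat -> 'rV[R]_n) :
  S !=set0 -> (forall s k, S s -> enorm (s - x k.+1) <= enorm (s - x k)) ->
  cluster (x k @[k --> \oo]) `<=` S ->
  exists2 l, S l & x k @[k --> \oo] --> l.
Proof.
move=> [s Ss] fejer clS.
have fejerD t k p : S t -> enorm (t - x (k + p)%N) <= enorm (t - x k).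
  move=> St; elim: p => [|p]; first by rewrite addn0.
  by rewrite addnS; exact/le_trans/fejer.
pose r := enorm (s - x 0%N) + 1.
have r0 : 0 < r by rewrite ltr_wpDl ?enorm_ge0.
have cpt : compact (closed_ball s r).
  apply: bounded_closed_compact; last exact: closed_ball_closed.
  exists (`|s| + r); split; first exact: num_real.
  move=> M ltM y; rewrite closed_ballE//= => sy.
  apply: le_trans (ltW ltM); rewrite -[y](subKr s).
  exact: le_trans (ler_normB _ _) (lerD (lexx _) sy).
have [] := cpt (x k @[k --> \oo]).
  exists 0%N => // k _; rewrite /= closed_ballE//=.
  apply: le_trans (norm_le_enorm _) _.
  by rewrite -[k]add0n; apply: le_trans (fejerD s 0%N k Ss) _; rewrite lerDl.
move=> l [_ cl]; exists l; first exact: clS.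
apply/cvgrPdist_le => e e0.
(* Closeness is obtained in the sup norm but Fejer monotonicity is Euclidean, whence the factor
   [Num.sqrt n%:R]; the [+ 1] keeps the divisor positive when [n = 0]. *)
have d0 : 0 < e / (Num.sqrt n%:R + 1) by rewrite divr_gt0// ltr_wpDl ?sqrtr_ge0.
have [] := cl (range x) (ball l (e / (Num.sqrt n%:R + 1))).
- by exists 0%N => // k _; exists k.
- exact: nbhsx_ballx.
move=> _ [[k _ <-]]; rewrite -ball_normE/= => lxk.
exists k => // j /= kj; apply: le_trans (norm_le_enorm _) _.
rewrite -(subnKC kj); apply: le_trans (fejerD l k _ (clS _ cl)) _.
apply: le_trans (enorm_le_norm _) _.
apply: (@le_trans _ _ ((Num.sqrt n%:R + 1) * `|l - x k|)).
  by rewrite ler_wpM2r// lerDl.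
by rewrite mulrC -ler_pdivlMr ?ltW// ltr_wpDl ?sqrtr_ge0.
Qed.

Lemma enorm_lipschitz_continuous (R : realType) (m : nat) (g : 'rV[R]_m -> R)
    (k : R) :
  (forall u v, `|g u - g v| <= k * enorm (u - v)) -> continuous g.
Proof.
move=> glip u; apply/(@cvgrPdist_le _ _ _ (nbhs u)) => e e0.
(* [k] has no assumed sign, hence the absolute value; the [+ 1] allows division by [c]. *)
pose c := `|k| * Num.sqrt m%:R + 1.
have c0 : 0 < c by rewrite ltr_wpDl// mulr_ge0 ?sqrtr_ge0.
near=> v.
have uv : `|u - v| <= e / c.
  near: v; apply/(@nbhs_normP _ _ u); exists (e / c) => [|v /ltW//].
  by rewrite /= divr_gt0.
apply: le_trans (glip _ _) _.
apply: (@le_trans _ _ (c * `|u - v|)); last by rewrite mulrC -ler_pdivlMr.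
apply: (@le_trans _ _ (`|k| * (Num.sqrt m%:R * `|u - v|))).
  apply: le_trans (ler_wpM2r (enorm_ge0 _) (ler_norm k)) _.
  exact: ler_wpM2l (enorm_le_norm _).
by rewrite mulrA ler_wpM2r// lerDl.
Unshelve. all: by end_near.
Qed.

(** * One step of the multiproximal method *)

Section Multiprox.
Context {R : realType} {n m : nat} {f : 'I_m -> 'rV[R]_n -> R} {L : 'rV[R]_m}.
Context {g : 'rV[R]_m -> R} {Lg : R}.
Hypothesis f_convex : forall i, convex_function setT (f i).
Hypothesis f_diff : forall i x, differentiable (f i) x.
Hypothesis L_ge0 : forall i, 0 <= L 0 i.
Hypothesis gradf_lip : forall i, elipschitz (L 0 i) (gradient (f i)).
Hypothesis g_convex : convex_function setT g.
Hypothesis g_lip : forall u v : 'rV[R]_m, `|g u - g v| <= Lg * enorm (u - v).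
Hypothesis g_mono : forall i, 0 < L 0 i -> nondecreasing_in i g.
Let F := vecfun f.
Implicit Types (x y z : 'rV[R]_n) (u v w : 'rV[R]_m).

(** The form in which monotonicity is used throughout: where [L 0 i = 0] nothing is known about the
    direction of [g], so equality is required there. *)
Let g_le u v : (forall i, u 0 i <= v 0 i) ->
  (forall i, L 0 i = 0 -> u 0 i = v 0 i) -> g u <= g v.
Proof.
move=> leuv equv.
apply: (nondecreasing_in_le (P := fun i => 0 < L 0 i)) => // i.
by rewrite -leNgt => Li; apply: equv; apply/eqP; rewrite eq_le Li L_ge0.
Qed.

(** A zero Lipschitz constant makes the upper and lower bounds on the model coincide: [f i] is
    affine. *)
Let model_exact x y i : L 0 i = 0 -> upper_model F L x y 0 i = F y 0 i.
Proof.
move=> Li0; apply/eqP; rewrite eq_le [F y 0 i]mxE le_upper_model// andbT.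
by have := upper_model_le f_diff L x y (f_convex i); rewrite Li0 !mul0r addr0.
Qed.

Lemma objective_le_model x y : g (F y) <= g (upper_model F L x y).
Proof.
apply: g_le => [i|i Li0]; last by rewrite model_exact.
by rewrite mxE; exact: le_upper_model.
Qed.

(** [Lg] itself may be negative when [m = 0]; the Lipschitz bound between [L] and 0 still gives the
    sign of the product. *)
Lemma lip_const_ge0 : 0 <= Lg * enorm L.
Proof. by have := g_lip L 0; rewrite subr0; exact: le_trans. Qed.

Lemma g_translate_le u (t : R) : g (u + t *: L) <= g u + Lg * enorm L * `|t|.
Proof.
rewrite -lerBlDl; apply: le_trans (ler_norm _) _.
apply: le_trans (g_lip _ _) _.
by rewrite addrAC subrr add0r enormZ mulrCA [leRHS]mulrC.
Qed.

(* Comparing [z] with the points [(1 - t) *: z + t *: y] and letting [t] go to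
   [0] replaces the usual subdifferential argument. *)
Lemma multiprox_le x y z : multiprox_step F g L x z ->
  g (upper_model F L x z) <=
    g (F y + ((enorm (y - x) ^+ 2 - enorm (y - z) ^+ 2) / 2) *: L).
Proof.
move=> zmin; set a := enorm (y - x) ^+ 2; set b := enorm (y - z) ^+ 2.
set h := upper_model F L x z; set v := F y + _.
have b0 : 0 <= b by rewrite sqr_ge0.
(* In the segment identity, [- t (1 - t) b / 2 = t (- b / 2 + t b / 2)]: the first term belongs to
   [v], the second is the remainder. Minimality of [z] and convexity of [g] then give
   [g h <= (1 - t) g h + t g w], from which [t] is cancelled. *)
have step (t : R) : 0 < t -> t <= 1 -> g h <= g (v + (t * (b / 2)) *: L).
  move=> t0 t1; set w := v + _.
  have hw : g (upper_model F L x ((1 - t) *: z + t *: y)) <=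
      g ((1 - t) *: h + t *: w).
    rewrite upper_model_segment -/h -/b; apply: g_le => [i|i Li0].
      have := upper_model_le f_diff L x y (f_convex i); rewrite -/F -/a => fle.
      have {}fle := ler_wpM2l (ltW t0) fle.
      move: (upper_model F L x y) fle => H fle.
      rewrite !mxE -subr_ge0; rewrite -subr_ge0 in fle.
      apply: le_trans fle _.
      by rewrite le_eqVlt; apply/orP; left; apply/eqP; ring.
    have := model_exact x y Li0; move: (upper_model F L x y) => H HE.
    by rewrite !mxE HE Li0 !mxE; ring.
  have : g h <= (1 - t) * g h + t * g w.
    apply: le_trans (zmin _) (le_trans hw _).
    rewrite [_ *: h + _]addrC [_ * g h + _]addrC.
    exact: (g_convex (Itv01 (ltW t0) t1) (in_setT w) (in_setT h)).
  have -> : (1 - t) * g h + t * g w = g h + t * (g w - g h) by ring.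
  by rewrite lerDl pmulr_rge0// subr_ge0.
apply/ler_addgt0Pr => e e0.
set c := Lg * enorm L * (b / 2).
have c0 : 0 <= c by rewrite mulr_ge0 ?lip_const_ge0// divr_ge0.
have c1 : 0 < c + 1 by rewrite ltr_wpDl.
(* By the Lipschitz bound the remainder costs at most [t * c]; this [t] makes it at most [e], with
   [c + 1] in place of [c] since [c] may be 0. *)
pose t := Num.min 1 (e / (c + 1)).
have t0 : 0 < t by rewrite lt_min ltr01 divr_gt0.
have t1 : t <= 1 by rewrite ge_min lexx.
apply: le_trans (step _ t0 t1) (le_trans (g_translate_le _ _) _).
rewrite lerD2l ger0_norm; last by rewrite mulr_ge0 ?divr_ge0// ltW.
have -> : Lg * enorm L * (t * (b / 2)) = t * c by rewrite mulrCA.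
have tec : t * (c + 1) <= e by rewrite -ler_pdivlMr// ge_min lexx orbT.
by apply: le_trans tec; rewrite ler_pM2l// lerDl.
Qed.

Lemma multiprox_descent x z : multiprox_step F g L x z -> g (F z) <= g (F x).
Proof.
move=> zmin; apply: le_trans (objective_le_model x z) _.
by rewrite -[in leRHS](upper_model_refl F L x).
Qed.

Lemma multiprox_fixed x : argmin (g \o F) x -> multiprox_step F g L x x.
Proof.
move=> xmin y; rewrite upper_model_refl.
exact: le_trans (xmin y) (objective_le_model x y).
Qed.

(** If [z] were strictly farther from [s] than [x], the shift along [L] in [multiprox_le] would be
    nonpositive in every coordinate and zero where [L 0 i = 0], so [g_le] would make [z] optimal. *)
Lemma multiprox_distance x z s :
  multiprox_step F g L x z -> argmin (g \o F) s ->
  ~ argmin (g \o F) z -> enorm (s - z) ^+ 2 <= enorm (s - x) ^+ 2.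
Proof.
move=> zmin smin; apply: contra_notT; rewrite -ltNge => lt_xz y.
apply: le_trans (smin y); apply: le_trans (objective_le_model x z) _.
apply: le_trans (multiprox_le s zmin) _; apply: g_le => [i|i Li0].
  rewrite mxE gerDl mxE mulr_le0_ge0//.
  by rewrite pmulr_lle0 ?invr_gt0// subr_le0 ltW.
by rewrite !mxE Li0 mulr0 addr0.
Qed.

(** The Lipschitz bound involves the absolute value of the shift; [multiprox_distance] shows that
    the shift is nonnegative, which leaves a telescoping difference. *)
Lemma multiprox_gap x z s : multiprox_step F g L x z -> argmin (g \o F) s ->
  ~ argmin (g \o F) z ->
  g (F z) - g (F s) <=
    Lg * enorm L / 2 * (enorm (s - x) ^+ 2 - enorm (s - z) ^+ 2).
Proof.
move=> zmin smin nz; have dle := multiprox_distance zmin smin nz.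
rewrite lerBlDl; apply: le_trans (objective_le_model x z) _.
apply: le_trans (multiprox_le s zmin) (le_trans (g_translate_le _ _) _).
rewrite lerD2l ger0_norm; last by rewrite divr_ge0// subr_ge0.
by rewrite mulrA mulrAC.
Qed.

(** * The whole sequence: complexity and convergence *)

Variable x : nat -> 'rV[R]_n.
Hypothesis x_seq : multiproximal_sequence F g L x.

(** Since [multiprox_step] may contain several points, this rests on the rule that the sequence
    stays put at a fixed point. *)
Lemma multiprox_stationary k p : argmin (g \o F) (x k) -> x (k + p) = x k.
Proof.
move=> kmin; elim: p => [|p IHp]; first by rewrite addn0.
have [_] := x_seq (k + p); rewrite IHp addnS; apply.
exact: multiprox_fixed.
Qed.

(** The gaps telescope, and descent of the values lets the last gap stand for all [k] of them. By
    stationarity, no earlier iterate is a solution either, so [multiprox_gap] applies at each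
    step. *)
Lemma multiprox_rate s k : argmin (g \o F) s -> ~ argmin (g \o F) (x k) ->
  k%:R * (g (F (x k)) - g (F s)) <=
    Lg * enorm L / 2 * (enorm (s - x 0%N) ^+ 2 - enorm (s - x k) ^+ 2).
Proof.
move=> smin; elim: k => [|k IHk] nmin; first by rewrite mul0r subrr mulr0.
have nmink : ~ argmin (g \o F) (x k).
  move=> kmin; apply: nmin.
  by have := multiprox_stationary 1 kmin; rewrite addn1 => ->.
have [stepk _] := x_seq k.
have gap := multiprox_gap stepk smin nmin.
have := ler_wpM2l (ler0n R k) (multiprox_descent stepk).
have {IHk} := IHk nmink; move: gap; rewrite -[k.+1%:R]natr1 mulrDl mul1r.
by rewrite !mulrBr; lra.
Qed.

Lemma multiprox_rate_dist s k : argmin (g \o F) s -> (1 <= k)%N ->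
  g (F (x k)) - g (F s) <=
    Lg * enorm L / (2 * k%:R) * enorm (x 0%N - s) ^+ 2.
Proof.
move=> smin k1; have k0 : 0 < k%:R :> R by rewrite ltr0n.
rewrite -[x 0%N - s]opprB -[- (s - x _)]scaleN1r enormZ normrN1 mul1r.
have [kmin|nkmin] := pselect (argmin (g \o F) (x k)).
  apply: (@le_trans _ _ 0); first by rewrite subr_le0; exact: kmin.
  by rewrite mulr_ge0 ?sqr_ge0// divr_ge0 ?lip_const_ge0// mulr_ge0// ltW.
rewrite -(ler_pM2l k0); apply: le_trans (multiprox_rate smin nkmin) _.
rewrite [leRHS](_ : _ = Lg * enorm L / 2 * enorm (s - x 0%N) ^+ 2).
  by rewrite ler_wpM2l ?divr_ge0 ?lip_const_ge0// gerBl sqr_ge0.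
by field; rewrite gt_eqF.
Qed.

Lemma multiprox_cvg : argmin (g \o F) !=set0 ->
  exists2 l, argmin (g \o F) l & x k @[k --> \oo] --> l.
Proof.
move=> sol0; have [s smin] := sol0.
have [[k kmin]|nmin] := pselect (exists k, argmin (g \o F) (x k)).
  exists (x k) => //; apply: cvg_near_cst; exists k => // j /= kj.
  by rewrite -(subnKC kj) multiprox_stationary.
have {}nmin k : ~ argmin (g \o F) (x k) by move=> kmin; apply: nmin; exists k.
apply: fejer_cvg => // [t k tmin|l cl].
  rewrite -(@ler_pXn2r _ 2%N) ?nnegrE ?enorm_ge0//.
  have [stepk _] := x_seq k.
  exact: multiprox_distance stepk tmin (nmin k.+1).
have gF_cont : {for l, continuous (g \o F)}.
  apply: continuous_comp; last exact: enorm_lipschitz_continuous g_lip _.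
  exact/differentiable_continuous/differentiable_vecfun.
move=> y; apply: le_trans (smin y).
apply/ler_addgt0Pr => e e0; rewrite leNgt; apply/negP => lt_l.
set c := Lg * enorm L / 2 * enorm (s - x 0%N) ^+ 2.
(* The rate puts all iterates with [k >= c / e] in the first set, and continuity makes the second a
   neighbourhood of [l]; a cluster point would force these disjoint sets to meet. *)
have [] := cl [set z | (g \o F) z <= (g \o F) s + e]
              [set z | (g \o F) s + e < (g \o F) z].
- suff : \forall k \near \oo, (g \o F) (x k) <= (g \o F) s + e by [].
  near=> k => /=.
  have k0 : 0 < k%:R :> R by rewrite ltr0n; near: k; exact: nbhs_infty_gt.
  rewrite -lerBlDl -(ler_pM2l k0).
  apply: le_trans (multiprox_rate smin (nmin k)) _.
  apply: (@le_trans _ _ c).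
    by rewrite ler_wpM2l ?divr_ge0 ?lip_const_ge0// gerBl sqr_ge0.
  by rewrite -ler_pdivrMr//; near: k; exact: nbhs_infty_ger.
- exact: (cvgr_gt _ gF_cont).
- by move=> z [/= zle]; rewrite ltNge zle.
Unshelve. all: by end_near.
Qed.

End Multiprox.

Theorem corollary2 (R : realType) (n m : nat)
    (f : 'I_m -> 'rV[R]_n -> R) (L : 'rV[R]_m)
    (g : 'rV[R]_m -> R) (Lg : R)
    (f_convex : forall i, convex_function setT (f i))
    (f_C1 : forall i, continuously_differentiable (f i))
    (L_ge0 : forall i, 0 <= L 0 i)
    (gradf_lip : forall i, elipschitz (L 0 i) (gradient (f i)))
    (g_convex : convex_function setT g)
    (g_lip : forall u v : 'rV[R]_m, `|g u - g v| <= Lg * enorm (u - v))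
    (g_mono : forall i, 0 < L 0 i -> nondecreasing_in i g)
    (F := vecfun f)
    (Sol := argmin (g \o F))
    (Sol_nonempty : Sol !=set0)
    (x : nat -> 'rV[R]_n)
    (x_seq : multiproximal_sequence F g L x) :
  (exists2 xlim : 'rV[R]_n, Sol xlim & x k @[k --> \oo] --> xlim) /\
  (forall xs : 'rV[R]_n, Sol xs -> forall k : nat, (1 <= k)%N ->
     g (F (x k)) - g (F xs)
       <= Lg * enorm L / (2 * k%:R) * enorm (x 0%N - xs) ^+ 2).
Proof.
have f_diff i z : differentiable (f i) z by have [] := f_C1 i.
split=> [|xs smin k k_ge1].
  exact: (multiprox_cvg f_convex f_diff L_ge0 gradf_lip g_convex g_lip g_mono
            x_seq).
exact: (multiprox_rate_dist f_convex f_diff L_ge0 gradf_lip g_convex g_lip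
          g_mono x_seq smin k_ge1).
Qed.
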